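(* Let $X$ be a zero-dimensional Hausdorff topological space. Then $X$ is $c_c$-realcompact if and only if $X$ is $c$-realcompact.
   Context: A Hausdorff space is zero-dimensional if it has a base of clopen sets. $C(X)$ is the ring of all real-valued continuous functions on $X$, and $C_c(X)$ is the subring of those $f\in C(X)$ for which $f(X)$ is a countable set. $C(X,\mathbb{Z})$ is the set of continuous functions $X\to\mathbb{Z}$, where $\mathbb{Z}$ has the discrete topology. A maximal ideal $M$ of $C_c(X)$ is called real if the residue class field $C_c(X)/M$ is isomorphic to the field $\mathbb{R}$; it is called fixed if there is a point $x\in X$ such that $f(x)=0$ for every $f\in M$. $X$ is $c$-realcompact if every real maximal ideal of $C_c(X)$ is fixed. A family $\mathcal{F}$ of subsets of $X$ is $c$-stable if for every $f\in C(X,\mathbb{Z})$ there exists $F\in\mathcal{F}$ such that $f$ is bounded on $F$. A topological space $X$ is $c_c$-realcompact if every $c$-stable family of closed sets in $X$ with the finite intersection property has nonempty intersection. *)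

(* Defs.v *)
From HB Require Import structures.
From mathcomp Require Import all_boot all_order all_algebra.
From mathcomp Require Import generic_quotient ring_quotient.
From mathcomp Require Import all_classical all_reals.
From mathcomp Require Import topology normedtype.

Set Implicit Arguments.
Unset Strict Implicit.
Unset Printing Implicit Defensive.

Import Order.TTheory GRing.Theory Num.Theory.
Import numFieldNormedType.Exports.

Local Open Scope classical_set_scope.
Local Open Scope ring_scope.

(** Ideals and residue class rings of a commutative ring.  The library's
    [idealr] and its quotient ring require [1 != 0] in the ambient ring, but
    the ring C_c(X) (called [Cc X R] here) is the zero ring when X is empty,
    hence the versions below for [comPzRingType].  Ideals are boolean predicates; by [asbool] any
    [Prop]-valued ideal has this form. *)

HB.mixin Record isMulAbsorbing (A : pzRingType) (S : A -> bool) := {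
  mul_absorbing_subproof : forall a : A, {in S, forall u, a * u \in S}
}.

#[short(type="ideal")]
HB.structure Definition Ideal (A : pzRingType) :=
  {S of GRing.ZmodClosed A S & isMulAbsorbing A S}.

Lemma mul_absorbing (A : pzRingType) (I : ideal A) (a u : A) :
  u \in I -> a * u \in I.
Proof. exact: mul_absorbing_subproof. Qed.

Definition maximal_ideal (A : pzRingType) (M : ideal A) : Prop :=
  1 \notin M /\
  forall J : ideal A, 1 \notin J -> {subset M <= J} -> {subset J <= M}.

Definition residue_ring (A : comPzRingType) (I : ideal A) : Type :=
  @Quotient.quot A I.

Section ResidueRing.
Local Open Scope quotient_scope.
Variables (A : comPzRingType) (I : ideal A).
Local Notation Q := (@Quotient.quot A I).

HB.instance Definition _ := GRing.Zmodule.on (residue_ring I).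

Definition residue (x : A) : residue_ring I := \pi_Q x.

Definition residue_mul (x y : residue_ring I) : residue_ring I :=
  residue (repr (x : Q) * repr (y : Q)).

Lemma residue_eq (x y : A) : (residue x == residue y) = (x - y \in I).
Proof. by rewrite Quotient.idealrBE. Qed.

Lemma residue_surj (x : residue_ring I) : exists a, x = residue a.
Proof. by exists (repr (x : Q)); rewrite /residue reprK. Qed.

Lemma residueD (x y : A) : residue (x + y) = residue x + residue y.
Proof. exact: Quotient.pi_add. Qed.

Lemma residueM (x y : A) : residue (x * y) = residue_mul (residue x) (residue y).
Proof.
have key z : z - repr (residue z : Q) \in I.
  by rewrite -residue_eq /residue reprK.
apply/eqP; rewrite residue_eq; set x' := repr (residue x : Q).
set y' := repr (residue y : Q).
have -> : x * y - x' * y' = y * (x - x') + x' * (y - y').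
  by rewrite !mulrBr (mulrC y x) (mulrC x' y) addrA subrK.
by rewrite rpredD ?mul_absorbing.
Qed.

Fact residueB : {morph residue : x y / x - y}.
Proof.
by move=> x y; rewrite residueD; congr (_ + _); exact: Quotient.pi_opp.
Qed.

Fact residue_mulA : associative residue_mul.
Proof.
move=> x y z; have [a ->] := residue_surj x; have [b ->] := residue_surj y.
by have [c ->] := residue_surj z; rewrite -!residueM mulrA.
Qed.

Fact residue_mulC : commutative residue_mul.
Proof.
move=> x y; have [a ->] := residue_surj x; have [b ->] := residue_surj y.
by rewrite -!residueM mulrC.
Qed.

Fact residue_mul1 : left_id (residue 1) residue_mul.
Proof. by move=> x; have [a ->] := residue_surj x; rewrite -residueM mul1r. Qed.

Fact residue_mulDl : left_distributive residue_mul +%R.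
Proof.
move=> x y z; have [a ->] := residue_surj x; have [b ->] := residue_surj y.
by have [c ->] := residue_surj z; rewrite -residueD -!residueM -residueD mulrDl.
Qed.

HB.instance Definition _ := GRing.Zmodule_isComPzRing.Build (residue_ring I)
  residue_mulA residue_mulC residue_mul1 residue_mulDl.

HB.instance Definition _ := GRing.isZmodMorphism.Build A (residue_ring I)
  residue residueB.
HB.instance Definition _ := GRing.isMonoidMorphism.Build A (residue_ring I)
  residue (erefl, residueM).

End ResidueRing.

Section Cc.
Variables (X : topologicalType) (R : realType).

Definition Cc_pred : {pred X -> R} :=
  fun f => `[< continuous f /\ countable (range f) >].

Lemma Cc_predP (f : X -> R) :
  reflect (continuous f /\ countable (range f)) (f \in Cc_pred).
Proof. exact: asboolP. Qed.

Lemma countable_range_op2 (op : R -> R -> R) (f g : X -> R) :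
  countable (range f) -> countable (range g) ->
  countable (range (fun x => op (f x) (g x))).
Proof.
move=> cf cg; apply: sub_countable (countableX cf cg).
apply: card_le_trans (card_image_le (fun p => op p.1 p.2) _).
apply: subset_card_le => _ [x _ <-]; exists (f x, g x) => //.
Qed.

Fact Cc_subring_closed : subring_closed Cc_pred.
Proof.
split=> [|f g /Cc_predP[cf kf] /Cc_predP[cg kg]|
          f g /Cc_predP[cf kf] /Cc_predP[cg kg]]; apply/Cc_predP; split.
- exact: cst_continuous.
- apply: (sub_countable _ (countable1 (1 : R))).
  by apply: subset_card_le => _ [x _ <-].
- by move=> x; apply: continuousB; [exact: cf|exact: cg].
- exact: (@countable_range_op2 (fun a b => a - b) f g).
- by move=> x; apply: continuousM; [exact: cf|exact: cg].
- exact: (@countable_range_op2 (fun a b => a * b) f g).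
Qed.

HB.instance Definition _ :=
  GRing.isSubringClosed.Build (X -> R) Cc_pred Cc_subring_closed.

Record Cc := MkCc { Cc_fun :> X -> R; Cc_funP : Cc_fun \in Cc_pred }.

HB.instance Definition _ := [isSub for Cc_fun].
HB.instance Definition _ := [Choice of Cc by <:].
HB.instance Definition _ :=
  GRing.SubChoice_isSubComPzRing.Build _ _ Cc (subringClosedP _).

(* For maximal M the residue ring is a field, and a field isomorphism is just
   a ring isomorphism. *)
Definition real_ideal (M : ideal Cc) : Prop :=
  exists phi : {rmorphism residue_ring M -> R}, bijective phi.

Definition fixed_ideal (M : ideal Cc) : Prop :=
  exists x : X, forall f : Cc, f \in M -> f x = 0.

Definition c_realcompact : Prop :=
  forall M : ideal Cc, maximal_ideal M -> real_ideal M -> fixed_ideal M.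

End Cc.

Section CcRealcompact.
Variable X : topologicalType.

(* Strictly stronger than the library's [zero_dimensional], which only asks
   that distinct points be separated by a clopen set. *)
Definition has_clopen_base : Prop :=
  exists2 B : set (set X), basis B & B `<=` clopen.

Definition c_stable (F : set (set X)) : Prop :=
  forall f : X -> int, continuous (f : X -> discrete_topology int) ->
    exists2 A, F A & exists k : int, forall x, A x -> `|f x| <= k.

Definition cc_realcompact : Prop :=
  forall F : set (set X), F `<=` closed -> c_stable F -> finI F id ->
    \bigcap_(A in F) A !=set0.

End CcRealcompact.

(* Main.v *)
(** If M is a real maximal ideal of C_c(X), the zero sets of its members form a
    c-stable family of closed sets with the finite intersection property, and a
    point common to all of them witnesses that M is fixed.

    Conversely, let F be a c-stable closed family with the finite intersection
    property and extend it to an ultrafilter G of subsets of X.  Each f in C_c(X)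
    lies within bounded distance of a continuous integer-valued function, so it
    is bounded on some member of F and converges along G.  The limit along G is
    a surjective ring morphism C_c(X) -> R whose kernel is a real maximal ideal.
    If this kernel is fixed at x, then x lies in every clopen member of G; since
    each member of F is an intersection of clopen sets, x lies in all of F. *)

Require Import Defs.
From HB Require Import structures.
From mathcomp Require Import all_boot all_order all_algebra.
From mathcomp Require Import generic_quotient.
From mathcomp Require Import all_classical all_reals topology normedtype.
From mathcomp Require Import measure lebesgue_measure.
From mathcomp Require Import lra.

Set Implicit Arguments.
Unset Strict Implicit.
Unset Printing Implicit Defensive.

Import Order.TTheory GRing.Theory Num.Theory.
Import numFieldNormedType.Exports.

Local Open Scope classical_set_scope.
Local Open Scope ring_scope.

(** * Kernels of ring morphisms onto a field *)

Section Kernel.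
Variables (A : comPzRingType) (K : fieldType) (phi : {rmorphism A -> K}).

Definition kernel : A -> bool := fun a => phi a == 0.

Lemma kernelE a : (a \in kernel) = (phi a == 0).
Proof. by []. Qed.

Fact kernel_zmod_closed : zmod_closed kernel.
Proof.
split=> [|a b]; rewrite !kernelE ?rmorph0//.
by move=> /eqP pa /eqP pb; rewrite rmorphB pa pb subr0.
Qed.

Fact kernel_mul_absorbing (a : A) : {in kernel, forall u, a * u \in kernel}.
Proof.
by move=> u; rewrite !kernelE => /eqP pu; rewrite rmorphM pu mulr0.
Qed.

HB.instance Definition _ := GRing.isZmodClosed.Build A kernel kernel_zmod_closed.
HB.instance Definition _ := isMulAbsorbing.Build A kernel kernel_mul_absorbing.

Definition kernel_ideal : ideal A := Ideal.clone A kernel _.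

Local Notation Q := (residue_ring kernel_ideal).

(** The map induced by [phi] on the residue ring; by [residue_kernelE] the choice of representative
    does not matter. *)
Definition residue_kernel (x : Q) : K :=
  phi (repr (x : Quotient.quot kernel_ideal)).

Lemma residue_kernelE a : residue_kernel (residue kernel_ideal a) = phi a.
Proof.
apply/eqP; rewrite -subr_eq0 -rmorphB.
suff : repr (residue kernel_ideal a : Quotient.quot kernel_ideal) - a
         \in kernel_ideal by [].
by rewrite -residue_eq /residue reprK.
Qed.

Fact residue_kernelB : {morph residue_kernel : x y / x - y}.
Proof.
move=> x y; have [a ->] := residue_surj x; have [b ->] := residue_surj y.
by rewrite -rmorphB !residue_kernelE rmorphB.
Qed.

Fact residue_kernelM : monoid_morphism residue_kernel.
Proof.
split=> [|x y]; first by rewrite -[1]/(residue _ 1) residue_kernelE rmorph1.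
have [a ->] := residue_surj x; have [b ->] := residue_surj y.
by rewrite -rmorphM !residue_kernelE rmorphM.
Qed.

HB.instance Definition _ :=
  GRing.isZmodMorphism.Build Q K residue_kernel residue_kernelB.
HB.instance Definition _ :=
  GRing.isMonoidMorphism.Build Q K residue_kernel residue_kernelM.

Definition residue_kernel_rmorphism : {rmorphism Q -> K} := residue_kernel.

Hypothesis phi_surj : forall c, exists a, phi a = c.

Lemma residue_kernel_bij : bijective residue_kernel.
Proof.
have [g gK] := choice phi_surj.
exists (fun c => residue kernel_ideal (g c)) => [x|c]; last first.
  by rewrite residue_kernelE gK.
have [a ->] := residue_surj x; apply/eqP; rewrite residue_kernelE residue_eq.
by rewrite kernelE rmorphB gK subrr.
Qed.

(** By surjectivity, an element [a] of [J] outside the kernel has an inverse modulo the kernel, so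
    [J] would contain 1. *)
Lemma kernel_maximal : maximal_ideal kernel_ideal.
Proof.
split=> [|J J1 sMJ a aJ]; first by rewrite kernelE rmorph1 oner_eq0.
rewrite kernelE; apply: contraNT J1 => pa0.
have [b pb] := phi_surj (phi a)^-1.
have ba1 : b * a - 1 \in J.
  by apply: sMJ; rewrite kernelE rmorphB rmorphM rmorph1 pb mulVf// subrr.
rewrite -[1](subKr (b * a)).
by rewrite rpredB// mul_absorbing.
Qed.

End Kernel.

(** * Locally constant maps, clopen sets and countable images *)

Lemma near_eq_continuous (X Y : topologicalType) (f : X -> Y) :
  (forall x, \forall y \near x, f y = f x) -> continuous f.
Proof. by move=> fE x; apply: cvg_near_cst; exact: fE. Qed.

Lemma discrete_near_eq (X : topologicalType) (T : choiceType)
    (f : X -> discrete_topology T) :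
  continuous f -> forall x, \forall y \near x, f y = f x.
Proof. by move=> cf x; have /discrete_cvg := cf x. Qed.

(** Both [V] and its complement are open, so membership in [V] is locally constant. *)
Lemma indic_near_eq (X : topologicalType) (T : Type) (V : set X) (a b : T) :
  clopen V -> forall x, \forall y \near x,
    (if y \in V then a else b) = (if x \in V then a else b).
Proof.
move=> [oV cV] x; have [xV|xV] := boolP (x \in V).
  have : nbhs x V by apply: open_nbhs_nbhs; split=> //; exact/set_mem.
  by apply: filterS => y /mem_set ->.
have : nbhs x (~` V).
  apply: open_nbhs_nbhs; split; first exact: closed_openC.
  by move=> /mem_set; exact/negP.
by apply: filterS => y /= yV; rewrite memNset.
Qed.

Lemma basis_clopen_separated (X : topologicalType) (A : set X) (x : X) :
  has_clopen_base X -> closed A -> ~ A x ->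
  exists V, [/\ clopen V, A `<=` V & ~ V x].
Proof.
move=> [B [oB Bx] Bclopen] cA nAx.
have /Bx[U [BU Ux] /= UA] : nbhs x (~` A).
  by apply: open_nbhs_nbhs; split=> //; exact: closed_openC.
exists (~` U); split; [exact: clopenC (Bclopen _ BU)| |by []].
by move=> y Ay Uy; exact: UA Uy Ay.
Qed.

Lemma countable_image (T U : Type) (f : T -> U) (A : set T) :
  countable A -> countable (f @` A).
Proof. exact/sub_countable/card_image_le. Qed.

(** * Some members of C_c(X) *)

Section CcFunctions.
Variables (X : topologicalType) (R : realType).

Lemma CcD (f g : Cc X R) x : (f + g) x = f x + g x. Proof. by []. Qed.
Lemma CcB (f g : Cc X R) x : (f - g) x = f x - g x. Proof. by []. Qed.
Lemma CcM (f g : Cc X R) x : (f * g) x = f x * g x. Proof. by []. Qed.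
Lemma Cc_nat n x : (n%:R : Cc X R) x = n%:R.
Proof. by elim: n => // n IH; rewrite -!natr1 CcD IH. Qed.

Lemma cst_Cc (c : R) : (fun=> c) \in @Cc_pred X R.
Proof.
apply/Cc_predP; split; first exact: cst_continuous.
by apply: (sub_countable _ (countable1 c)); apply: subset_card_le => _ [x _ <-].
Qed.

Definition Cc_cst (c : R) : Cc X R := MkCc (cst_Cc c).

Lemma int_Cc (f : X -> int) :
  continuous (f : X -> discrete_topology int) ->
  (fun x => (f x)%:~R) \in @Cc_pred X R.
Proof.
move=> /discrete_near_eq fE; apply/Cc_predP; split.
  by apply: near_eq_continuous => x; near=> y; congr _%:~R; near: y; exact: fE.
have : countable [set (n%:~R : R) | n in [set: int]].
  exact: countable_image.
by apply: sub_countable; apply: subset_card_le => _ [x _ <-]; exists (f x).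
Unshelve. all: by end_near. Qed.

Lemma inv_Cc (f : Cc X R) :
  (forall x, f x != 0) -> (fun x => (f x)^-1) \in @Cc_pred X R.
Proof.
case: f => f /= /Cc_predP[cf kf] f0; apply/Cc_predP; split.
  by move=> x; apply: cvgV; [exact: f0|exact: cf].
have : countable (GRing.inv @` range f) by exact: countable_image.
by apply: sub_countable; apply: subset_card_le => _ [x _ <-]; exists (f x).
Qed.

End CcFunctions.

(** * Zero sets of a real ideal *)

Section RealIdealToFilter.
Variables (X : topologicalType) (R : realType) (M : ideal (Cc X R)).

Definition zero_set (f : Cc X R) : set X := [set x | f x = 0].

Lemma zero_set_closed f : closed (zero_set f).
Proof.
have /Cc_predP[cf _] := Cc_funP f.
by apply: (@preimage_closed _ _ f [set 0]) => //; exact: closed_eq.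
Qed.

(** A sum of two real squares vanishes only if both do; hence the zero sets of an ideal are closed
    under binary intersection. *)
Lemma zero_setSS f g : zero_set (f * f + g * g) = zero_set f `&` zero_set g.
Proof.
apply/seteqP; split=> x; rewrite /zero_set/setI/mkset CcD !CcM; last first.
  by move=> [-> ->]; rewrite mulr0 addr0.
move/eqP; rewrite paddr_eq0 -?expr2 ?sqr_ge0// !sqrf_eq0.
by move=> /andP[/eqP ? /eqP ?].
Qed.

(** A function without zeros is invertible in [Cc X R], so it lies in no proper ideal. *)
Lemma zero_set_neq0 f : 1 \notin M -> f \in M -> zero_set f !=set0.
Proof.
move=> M1 fM; apply: contrapT => /set0P/negP/negbNE/eqP Z0.
have f0 x : f x != 0.
  by apply/eqP => fx; have : zero_set f x by []; rewrite Z0.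
move/negP: M1; apply; rewrite (_ : 1 = MkCc (inv_Cc f0) * f) ?mul_absorbing//.
by apply/val_inj/funext => x /=; rewrite /GRing.mul/= mulVf.
Qed.

(** The zero sets are nonempty and directed downwards, hence a base of a proper filter. *)
Lemma zero_sets_finI : 1 \notin M -> finI (zero_set @` [set f | f \in M]) id.
Proof.
move=> M1; pose F := filter_from [set f | f \in M] zero_set.
have FF : ProperFilter F.
  apply: filter_from_proper => [|f fM]; last exact: zero_set_neq0.
  apply: filter_from_filter => [|f g fM gM]; first by exists 0; exact: rpred0.
  exists (f * f + g * g); last by rewrite zero_setSS.
  by rewrite /= rpredD// mul_absorbing.
by apply: (@filter_finI _ F) => _ [f fM <-]; exists f.
Qed.

(* For f integer-valued and n > |phi f|, the number n^2 - (phi f)^2 is a square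
   (phi g)^2, so that n^2 - f^2 - g^2 lies in M and |f| <= n where it vanishes. *)
Lemma zero_sets_c_stable :
  real_ideal M -> c_stable (zero_set @` [set f | f \in M]).
Proof.
move=> [phi [psi phiK psiK]] f cf.
pose f' : Cc X R := MkCc (@int_Cc X R f cf).
pose p (h : Cc X R) : R := phi (residue M h).
pose n := (Num.trunc `|p f'|).+1.
have nE : `|p f'| <= n%:R by exact/ltW/truncnS_gt.
have [g gE] := residue_surj (psi (Num.sqrt (n%:R ^+ 2 - p f' ^+ 2))).
have pg : p g ^+ 2 = n%:R ^+ 2 - p f' ^+ 2.
  rewrite /p -gE psiK sqr_sqrtr// subr_ge0 -[leLHS]real_normK ?num_real//.
  by rewrite ler_pXn2r ?nnegrE.
pose h := n%:R ^+ 2 - f' ^+ 2 - g ^+ 2.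
exists (zero_set h).
  exists h => //=; rewrite -[h]subr0 -residue_eq; apply/eqP.
  apply: (can_inj phiK); rewrite /h !rmorphB !rmorphXn /= !rmorph_nat !rmorph0.
  by apply/eqP; rewrite subr_eq0 -/(p f') -/(p g) pg.
exists n%:Z => x; rewrite /zero_set/mkset => hx.
have : (f x)%:~R ^+ 2 <= n%:R ^+ 2 :> R.
  rewrite -subr_ge0; suff -> : n%:R ^+ 2 - (f x)%:~R ^+ 2 = g x ^+ 2 :> R.
    exact: sqr_ge0.
  apply/eqP; rewrite -subr_eq0 -hx.
  by rewrite /h !CcB !expr2 !CcM Cc_nat.
rewrite -[leLHS]real_normK ?num_real// ler_pXn2r ?nnegrE//.
by rewrite -intr_norm -[n%:R]/(n%:Z%:~R) ler_int.
Qed.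

End RealIdealToFilter.

Lemma cc_realcompact_c_realcompact (R : realType) (X : topologicalType) :
  cc_realcompact X -> c_realcompact X R.
Proof.
move=> ccX M [M1 _] realM.
have clM : zero_set (R:=R) @` [set f | f \in M] `<=` closed.
  by move=> _ [f _ <-]; exact: zero_set_closed.
have [x xM] := ccX _ clM (zero_sets_c_stable realM) (zero_sets_finI M1).
by exists x => f fM; apply: (xM (zero_set f)); exists f.
Qed.

(** * Limits along an ultrafilter *)

Section UltrafilterToRealIdeal.
Variables (X : topologicalType) (R : realType).

(** Otherwise the unit interval would be countable, hence of Lebesgue measure 0 instead of 1. *)
Lemma countable_setC_neq0 (A : set R) : countable A -> exists a, ~ A a.
Proof.
move=> cA; apply: contrapT => /forallNP nA.
have AT : A = setT by apply/seteqP; split=> // x _; exact: contrapT (nA x).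
have c01 : countable (`[0, 1]%classic : set R).
  by apply: (sub_countable _ cA); rewrite AT; exact/subset_card_le/subsetT.
have := countable_lebesgue_measure0 c01; rewrite lebesgue_measure_itv/=.
by rewrite lte_fin ltr01 oppr0 adde0 => /eqP; rewrite eqe oner_eq0.
Qed.

(* [a] is chosen so that the countable range of [f] misses the coset a + Z. *)
Lemma Cc_floor (f : Cc X R) : exists a : R,
  continuous ((fun x => Num.floor (f x - a)) : X -> discrete_topology int).
Proof.
have /Cc_predP[cf kf] := Cc_funP f.
have [a aP] : exists a : R,
    ~ [set p.1 - p.2%:~R | p in range f `*` [set: int]] a.
  by apply: countable_setC_neq0; apply/countable_image/countableX.
exists a; apply: near_eq_continuous => x; set n := Num.floor (f x - a).
(* The choice of [a] rules out equality, so [f - a] stays strictly between [n] and [n + 1] near [x]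
   and its floor is constant there. *)
have nlt : n%:~R < f x - a.
  rewrite lt_neqAle floor_le andbT; apply/eqP => nE; apply: aP.
  by exists (f x, n) => //=; [split=> //; exists x|rewrite nE subKr].
have ltn : f x - a < (n + 1)%:~R by exact: floorD1_gt.
have cfa : f y - a @[y --> x] --> f x - a by apply: cvgB (cf x) (cvg_cst a).
near=> y; apply: floor_def; apply/andP; split.
  by apply: ltW; near: y; exact: cvgr_gt cfa _ nlt.
by near: y; exact: cvgr_lt cfa _ ltn.
Unshelve. all: by end_near. Qed.

Variables (F G : set_system X).
Hypotheses (Fst : c_stable F) (UG : UltraFilter G) (FG : F `<=` G).

(** The values of [f] lie in a compact interval on a member of [G], and an ultrafilter converges to
    each of its cluster points. *)
Lemma Cc_ultra_cvg (f : Cc X R) : cvg (f @ G).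
Proof.
have [a /Fst[A FA [k Ak]]] := Cc_floor f.
(* If the floor of [f x - a] is at most [k] in absolute value, then [f x - a] is at least [-k] and
   less than [k + 1]. *)
pose I : set R := `[a - k%:~R, a + (k + 1)%:~R]%classic.
have GI : G (f @^-1` I).
  apply: (filterS _ (FG FA)) => x Ax; rewrite /I /= in_itv/=.
  have /ltW := floorD1_gt (f x - a); have := floor_le (f x - a).
  have := Ak _ Ax; rewrite ler_norml => /andP[].
  rewrite -!(ler_int R) !rmorphN !intrD /=; lra.
have [l [_ fGl]] := @segment_compact R _ _ (f @ G) _ GI.
apply/cvg_ex; exists l => U lU; have [//|GU] := in_ultra_setVsetC (f @^-1` U) UG.
by have [y []] := fGl (~` U) U GU lU.
Qed.

Definition ultra_lim (f : Cc X R) : R := lim (f @ G).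

Lemma ultra_limP (f : Cc X R) l : f @ G --> l -> ultra_lim f = l.
Proof. by move/cvg_lim; apply; exact: Rhausdorff. Qed.

Fact ultra_limB : {morph ultra_lim : f g / f - g}.
Proof.
by move=> f g; apply: ultra_limP; apply: cvgB; exact: Cc_ultra_cvg.
Qed.

Lemma ultra_lim_cst c : ultra_lim (Cc_cst X c) = c.
Proof. by apply: ultra_limP; exact: cvg_cst. Qed.

Fact ultra_limM : monoid_morphism ultra_lim.
Proof.
split=> [|f g]; first by apply: ultra_limP; exact: cvg_cst.
by apply: ultra_limP; apply: cvgM; exact: Cc_ultra_cvg.
Qed.

Definition ultra_lim_rmorphism : {rmorphism Cc X R -> R} :=
  HB.pack_for {rmorphism Cc X R -> R} ultra_lim
    (GRing.isZmodMorphism.Build _ _ ultra_lim ultra_limB)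
    (GRing.isMonoidMorphism.Build _ _ ultra_lim ultra_limM).

Lemma ultra_fixed_point :
  c_realcompact X R ->
  exists x, forall V, clopen V -> G V -> V x.
Proof.
move=> cX.
have surj c : exists f, ultra_lim_rmorphism f = c.
  by exists (Cc_cst X c); exact: ultra_lim_cst.
have [] := cX (kernel_ideal ultra_lim_rmorphism) (kernel_maximal surj).
  exists (residue_kernel_rmorphism ultra_lim_rmorphism).
  exact: residue_kernel_bij.
move=> x xM; exists x => V cV GV.
(* The indicator of the complement of [V] tends to 0 along [G], so it lies in the kernel and must
   vanish at [x]. *)
have iV : continuous ((fun y => if y \in V then 0 else 1) :
    X -> discrete_topology int).
  by apply: near_eq_continuous; exact: indic_near_eq.
have /xM/eqP/= : MkCc (int_Cc R iV) \in kernel_ideal ultra_lim_rmorphism.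
  apply/eqP; apply: ultra_limP; apply: cvg_near_cst.
  by apply: (filterS _ GV) => y Vy /=; rewrite mem_set.
by case: ifPn => [/set_mem//|_]; rewrite oner_eq0.
Qed.

End UltrafilterToRealIdeal.

(** * From fixed real ideals to common points of c-stable families *)

Lemma c_realcompact_cc_realcompact (R : realType) (X : topologicalType) :
  has_clopen_base X -> c_realcompact X R -> cc_realcompact X.
Proof.
move=> zX cX F clF stF /finI_filter FF.
have [G [UG FG]] := ultraFilterLemma FF.
have {}FG : F `<=` G.
  by move=> A FA; apply: FG; exists A => //; exact: (@finI_from1 _ _ F id).
have [x xG] := ultra_fixed_point stF UG FG cX.
exists x => A FA; apply: contrapT => nAx.
have [V [cV AV]] := basis_clopen_separated zX (clF _ FA) nAx.
by apply; apply: xG => //; exact: filterS AV (FG _ FA).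
Qed.

Theorem theorem2p3 (R : realType) (X : topologicalType)
    (hX : hausdorff_space X) (zX : has_clopen_base X) :
  cc_realcompact X <-> c_realcompact X R.
Proof.
split; first exact: cc_realcompact_c_realcompact.
exact: c_realcompact_cc_realcompact.
Qed.
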